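(* Let $\lambda\in\mathbb{R}$. For all $m,k\in\mathbb{Z}$ with $k\ge m\ge 0$, $$S_{1,\lambda}(k+1,m+1)=\sum_{l=m}^{k}S_{1,\lambda}(k,l)\left\{\binom{l}{m}\langle 1\rangle_{l-m,\lambda}(-1)^{l-m}+l\lambda\binom{l-1}{m}(-1)^{l-m-1}\langle 1\rangle_{l-m-1,\lambda}\right\},$$ where for $l=m$ the second term inside the braces is read as $0$.
   Context: For $\lambda\in\mathbb{R}$, the generalized falling factorials are $(x)_{0,\lambda}=1$, $(x)_{n,\lambda}=x(x-\lambda)\cdots(x-(n-1)\lambda)$ for $n\ge 1$; the ordinary falling factorials are $(x)_{0}=1$, $(x)_{n}=x(x-1)\cdots(x-n+1)$ for $n\ge 1$; and the degenerate rising factorials are $\langle x\rangle_{0,\lambda}=1$, $\langle x\rangle_{n,\lambda}=x(x+\lambda)\cdots(x+(n-1)\lambda)$ for $n\ge 1$. The degenerate Stirling numbers of the first kind $S_{1,\lambda}(n,k)$, $0\le k\le n$, are defined by the polynomial identity $(x)_{n}=\sum_{k=0}^{n}S_{1,\lambda}(n,k)(x)_{k,\lambda}$ for $n\ge 0$. *)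

(* Defs.v *)
From HB Require Import structures.
From mathcomp Require Import all_boot all_order all_algebra.
From mathcomp Require Import reals.

Set Implicit Arguments.
Unset Strict Implicit.
Unset Printing Implicit Defensive.

Import GRing.Theory.

Local Open Scope ring_scope.

Definition falling_factorial (A : comNzRingType) (x : A) (n : nat) : A :=
  \prod_(i < n) (x - i%:R).

Definition degenerate_falling_factorial
    (A : comNzRingType) (lambda x : A) (n : nat) : A :=
  \prod_(i < n) (x - i%:R * lambda).

Definition degenerate_rising_factorial
    (A : comNzRingType) (lambda x : A) (n : nat) : A :=
  \prod_(i < n) (x + i%:R * lambda).

Section DegenerateStirling1.

Variables (R : realType) (lambda : R).

Local Notation dff k :=
  (degenerate_falling_factorial lambda%:P ('X : {poly R}) k).

Lemma dff_prod_XsubC k : dff k = \prod_(i < k) ('X - (i%:R * lambda)%:P).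
Proof. by apply: eq_bigr => i _; rewrite polyCM polyC_natr. Qed.

Lemma size_dff k : size (dff k) = k.+1.
Proof.
by rewrite dff_prod_XsubC size_prod_XsubC /index_enum -enumT size_enum_ord.
Qed.

Lemma monic_dff k : dff k \is monic.
Proof. by rewrite dff_prod_XsubC monic_prod_XsubC. Qed.

Lemma size_falling_factorial n :
  size (falling_factorial ('X : {poly R}) n) = n.+1.
Proof.
have -> : falling_factorial ('X : {poly R}) n
          = \prod_(i < n) ('X - (i%:R : R)%:P).
  by apply: eq_bigr => i _; rewrite polyC_natr.
by rewrite size_prod_XsubC /index_enum -enumT size_enum_ord.
Qed.

Lemma dff_expansion n (p : {poly R}) : (size p <= n)%N ->
  exists s : n.-tuple R, p == \sum_(k < n) s`_k *: dff k.
Proof.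
elim: n p => [|n IHn] p le_p_n.
  by exists [tuple]; rewrite big_ord0 -size_poly_leq0.
have [|s /eqP Ds] := IHn (p - p`_n *: dff n).
  apply/leq_sizeP => j; rewrite leq_eqVlt => /predU1P[<-|lt_n_j].
    have := monic_dff n; rewrite monicE lead_coefE size_dff /= => /eqP Dn.
    by rewrite coefB coefZ Dn mulr1 subrr.
  rewrite coefB coefZ (nth_default _ (leq_trans le_p_n lt_n_j)).
  by rewrite [(dff n)`_j]nth_default ?size_dff // mulr0 subrr.
exists [tuple of rcons s p`_n]; rewrite big_ord_recr /=.
rewrite nth_rcons size_tuple ltnn eqxx -subr_eq Ds.
by apply/eqP/eq_bigr => k _; rewrite nth_rcons size_tuple ltn_ord.
Qed.

Lemma dff_expansion_unique n (a b : nat -> R) :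
  \sum_(k < n) a k *: dff k = \sum_(k < n) b k *: dff k ->
  forall k, (k < n)%N -> a k = b k.
Proof.
elim: n => [//|n IHn] eq_ab.
have coef_small (c : nat -> R) : (\sum_(k < n) c k *: dff k)`_n = 0.
  rewrite coef_sum big1 // => k _.
  by rewrite coefZ nth_default ?mulr0 // size_dff.
have Dn : (dff n)`_n = 1.
  by have := monic_dff n; rewrite monicE lead_coefE size_dff /= => /eqP.
have eq_n : a n = b n.
  have := congr1 (fun p : {poly R} => p`_n) eq_ab.
  by rewrite !big_ord_recr /= !coefD !coef_small !coefZ Dn !mulr1 !add0r.
move: eq_ab; rewrite !big_ord_recr /= eq_n => /addIr/IHn eq_lt k.
by rewrite ltnS leq_eqVlt => /predU1P[->|/eq_lt].
Qed.

Lemma degenerate_stirling1_subproof n :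
  exists s : n.+1.-tuple R,
    falling_factorial 'X n == \sum_(k < n.+1) s`_k *: dff k.
Proof. by apply: dff_expansion; rewrite size_falling_factorial. Qed.

(* The coordinates of (X)_n in the family (X)_{0,lambda}, ..., (X)_{n,lambda}; *)
(* they exist and are unique (see the two lemmas below), so the choice made by *)
(* xchoose is immaterial. The value is 0 when n < k.                           *)
Definition degenerate_stirling1 (n k : nat) : R :=
  (xchoose (degenerate_stirling1_subproof n))`_k.

Lemma degenerate_stirling1P n :
  falling_factorial 'X n = \sum_(k < n.+1) degenerate_stirling1 n k *: dff k.
Proof. exact/eqP/(xchooseP (degenerate_stirling1_subproof n)). Qed.

Lemma degenerate_stirling1_unique n (s : nat -> R) :
  falling_factorial 'X n = \sum_(k < n.+1) s k *: dff k ->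
  forall k, (k <= n)%N -> s k = degenerate_stirling1 n k.
Proof.
by rewrite degenerate_stirling1P => /esym/dff_expansion_unique eq_s k /eq_s.
Qed.

End DegenerateStirling1.

(* Main.v *)
Require Import Defs.
From mathcomp Require Import all_boot all_order all_algebra.
From mathcomp Require Import reals.
From mathcomp Require Import ring.

(** Write [(x)_n] for the falling factorials, [(x)_{n,lambda}] for the
    degenerate ones and [S(n, k)] for the Stirling numbers.  Since
    [(X)_{k+1} = X (X - 1)_k], substituting [X - 1] for [X] in the expansion
    that defines [S(k, l)] gives
    [(X)_{k+1} = \sum_l S(k, l) X (X - 1)_{l,lambda}].
    It remains to expand [X (X - 1)_{l,lambda}] in the family
    [(X)_{j,lambda}] and to compare coefficients.  The factor
    [(X - 1)_{l,lambda}] is handled by the degenerate Vandermonde identity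
    [degenerate_vandermonde], with [(-1)_{n,lambda} = (-1)^n <1>_{n,lambda}];
    multiplication by [X] sends [(X)_{i,lambda}] to
    [(X)_{i+1,lambda} + i lambda (X)_{i,lambda}].  Hence [(X)_{m+1,lambda}]
    receives one contribution from [i = m] and one from [i = m + 1]
    ([mulX_dff_sub1]): these are the two terms in the braces, once
    [(m + 1) 'C(l, m + 1)] is rewritten as [l 'C(l - 1, m)]. *)

Set Implicit Arguments.
Unset Strict Implicit.
Unset Printing Implicit Defensive.

Import GRing.Theory.

Local Open Scope ring_scope.

Local Notation ff := Defs.falling_factorial.
Local Notation dff := degenerate_falling_factorial.

Section FallingFactorials.

Variable A : comNzRingType.
Implicit Types lambda x y : A.

Lemma dff0 lambda x : dff lambda x 0 = 1.
Proof. exact: big_ord0. Qed.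

Lemma dffS lambda x n :
  dff lambda x n.+1 = dff lambda x n * (x - n%:R * lambda).
Proof. exact: big_ord_recr. Qed.

Lemma falling_factorialS_sub1 x n :
  ff x n.+1 = x * ff (x - 1) n.
Proof.
rewrite /ff big_ord_recl subr0; congr (_ * _).
by apply: eq_bigr => i _; rewrite -natr1 [_ + 1]addrC opprD addrA.
Qed.

Lemma dff_opp lambda x n :
  dff lambda (- x) n = (-1) ^+ n * degenerate_rising_factorial lambda x n.
Proof.
rewrite /dff /degenerate_rising_factorial.
rewrite -[X in (-1) ^+ X]card_ord -prodr_const -big_split /=.
by apply: eq_bigr => i _; rewrite mulN1r opprD.
Qed.

Lemma mulr_dff lambda x n :
  x * dff lambda x n = dff lambda x n.+1 + n%:R * lambda * dff lambda x n.
Proof. by rewrite dffS mulrBr [_ * (n%:R * _)]mulrC addrNK mulrC. Qed.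

(** Induction on [n]: the new factor [x + y - n lambda] splits as
    [(x - i lambda) + (y - (n - i) lambda)], which raises the degree of one of
    the two factors of the [i]-th term, and Pascal's rule regroups. *)
Lemma degenerate_vandermonde lambda x y n :
  dff lambda (x + y) n =
  \sum_(i < n.+1) 'C(n, i)%:R * dff lambda x i * dff lambda y (n - i).
Proof.
elim: n => [|n IHn]; first by rewrite big_ord1 !dff0 bin0 !mulr1.
rewrite dffS IHn mulr_suml.
transitivity
  (\sum_(i < n.+1) 'C(n, i)%:R * dff lambda x i.+1 * dff lambda y (n - i) +
   \sum_(i < n.+1) 'C(n, i)%:R * dff lambda x i * dff lambda y (n.+1 - i)).
  rewrite -big_split /=; apply: eq_bigr => i _.
  have le_in : (i <= n)%N by rewrite -ltnS.
  by rewrite subSn // !dffS natrB //; ring.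
rewrite [in RHS]big_ord_recl [X in _ + X = _]big_ord_recl /= !bin0 addrCA.
congr (_ + _).
(* Extending the second sum by its vanishing term [i = n + 1] aligns the
   ranges. *)
have -> : \sum_(i < n) 'C(n, bump 0 i)%:R * dff lambda x (bump 0 i) *
    dff lambda y (n.+1 - bump 0 i) =
  \sum_(i < n.+1) 'C(n, i.+1)%:R * dff lambda x i.+1 * dff lambda y (n - i).
  by rewrite big_ord_recr /= bin_small // !mul0r addr0.
rewrite -big_split /=; apply: eq_bigr => i _.
by rewrite /bump /= add1n subSS binS natrD !mulrDl addrC.
Qed.

End FallingFactorials.

Lemma rmorph_falling_factorial (A B : comNzRingType) (f : {rmorphism A -> B})
    x n :
  f (ff x n) = ff (f x) n.
Proof.
by rewrite rmorph_prod; apply: eq_bigr => i _; rewrite rmorphB rmorph_nat.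
Qed.

Lemma rmorph_dff (A B : comNzRingType) (f : {rmorphism A -> B}) lambda x n :
  f (dff lambda x n) = dff (f lambda) (f x) n.
Proof.
rewrite rmorph_prod; apply: eq_bigr => i _.
by rewrite rmorphB rmorphM rmorph_nat.
Qed.

Section Expansion.

Variables (R : comNzRingType) (lambda : R).

(** Coefficient of [(X)_{i,lambda}] in [(X - 1)_{l,lambda}]; it vanishes when
    [l < i], whatever the truncated difference [l - i] is. *)
Definition dff_sub1_coef l i : R := 'C(l, i)%:R * dff lambda (-1) (l - i).

Local Notation c := dff_sub1_coef.

Lemma dff_sub1_coef_small l i : (l < i)%N -> c l i = 0.
Proof. by move=> lt_li; rewrite /c bin_small // mul0r. Qed.

(** Coefficient of [(X)_{m+1,lambda}] in [X (X - 1)_{l,lambda}]: the first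
    term comes from [X (X)_{m,lambda}], the second one from
    [X (X)_{m+1,lambda}]. *)
Definition mulX_dff_sub1_coef l m : R := c l m + m.+1%:R * lambda * c l m.+1.

(** Distribute [X] over the Vandermonde expansion of [(X - 1)_{l,lambda}] and
    use [X (X)_{i,lambda} = (X)_{i+1,lambda} + i lambda (X)_{i,lambda}].
    The bound [N] is independent of [l], so that the sums obtained for various
    [l] can be added term by term. *)
Lemma mulX_dff_sub1 l N : (l < N)%N ->
  'X * dff lambda%:P ('X - 1 : {poly R}) l =
  \sum_(m < N) mulX_dff_sub1_coef l m *: dff lambda%:P 'X m.+1.
Proof.
move=> lt_lN.
have -> : dff lambda%:P ('X - 1 : {poly R}) l =
    \sum_(i < N) c l i *: dff lambda%:P 'X i.
  rewrite degenerate_vandermonde.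
  rewrite [RHS](bigID (fun i : 'I_N => (i < l.+1)%N)) /=.
  rewrite [X in _ = _ + X]big1 ?addr0 => [|i]; last first.
    by rewrite ltnS -ltnNge => /dff_sub1_coef_small->; rewrite scale0r.
  rewrite -(big_ord_widen _ (fun i => c l i *: dff lambda%:P 'X i)) //.
  apply: eq_bigr => i _.
  have -> : -1 = (-1)%:P :> {poly R} by rewrite polyCN.
  rewrite -(rmorph_dff (polyC : {rmorphism R -> {poly R}})) /= -mul_polyC.
  by rewrite /c polyCM polyC_natr mulrAC.
rewrite mulr_sumr.
under eq_bigr => i _.
  rewrite -scalerAr mulr_dff -polyC_natr -polyCM mul_polyC scalerDr scalerA.
  over.
under [RHS]eq_bigr => i _ do rewrite /mulX_dff_sub1_coef scalerDl.
rewrite !big_split /=; congr (_ + _).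
(* Shift the index: the term [i = 0] has the factor [0%:R], and the term
   [m = N - 1] has the coefficient [c l N], which is zero. *)
case: N lt_lN => [//|N] lt_lN.
rewrite big_ord_recl big_ord_recr /= (dff_sub1_coef_small lt_lN).
by rewrite !mul0r !mulr0 !scale0r add0r addr0; apply: eq_bigr => i _; rewrite mulrC.
Qed.

Lemma mulX_dff_sub1_coef_small l m :
  (l < m)%N -> mulX_dff_sub1_coef l m = 0.
Proof.
move=> lt_lm; rewrite /mulX_dff_sub1_coef.
by rewrite !dff_sub1_coef_small ?mulr0 ?addr0 // ltnW.
Qed.

(** The second terms agree because [(m + 1) 'C(l, m + 1) = l 'C(l - 1, m)]; for
    [l = m] the coefficient [c l m.+1] vanishes, hence the case distinction. *)
Lemma mulX_dff_sub1_coefE l m : (m <= l)%N ->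
  mulX_dff_sub1_coef l m =
  'C(l, m)%:R * degenerate_rising_factorial lambda 1 (l - m) * (-1) ^+ (l - m)
  + (if l == m then 0
     else l%:R * lambda * 'C(l - 1, m)%:R * (-1) ^+ (l - m - 1) *
          degenerate_rising_factorial lambda 1 (l - m - 1)).
Proof.
move=> le_ml; congr (_ + _); first by rewrite /c dff_opp mulrA mulrAC.
case: eqVneq => [->|neq_lm]; first by rewrite dff_sub1_coef_small ?mulr0.
case: l le_ml neq_lm => [|l] le_ml neq_lm; first by case: m le_ml neq_lm.
rewrite /c dff_opp -subnDA addn1 !subSS subn0 !mulrA; congr (_ * _ * _).
rewrite mulrAC -natrM [RHS]mulrAC -natrM.
by rewrite -mul_bin_diag.
Qed.

End Expansion.

Theorem theorem4 (R : realType) (lambda : R) (m k : nat) (le_mk : (m <= k)%N) :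
  degenerate_stirling1 lambda k.+1 m.+1 =
  \sum_(m <= l < k.+1)
    degenerate_stirling1 lambda k l *
    ('C(l, m)%:R * degenerate_rising_factorial lambda 1 (l - m) *
       (-1) ^+ (l - m)
     + (if l == m then 0
        else l%:R * lambda * 'C(l - 1, m)%:R * (-1) ^+ (l - m - 1) *
             degenerate_rising_factorial lambda 1 (l - m - 1))).
Proof.
pose b := mulX_dff_sub1_coef lambda.
(* The value [s 0] is zero because every term of the expansion of
   [X (X - 1)_k] has a positive index. *)
pose s j := if j is i.+1
  then \sum_(l < k.+1) degenerate_stirling1 lambda k l * b l i else 0.
rewrite -[LHS](@degenerate_stirling1_unique _ lambda k.+1 s) //; last first.
  rewrite falling_factorialS_sub1.
  have -> : ff ('X - 1 : {poly R}) k = ff 'X k \Po ('X - 1).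
    by rewrite rmorph_falling_factorial /= comp_polyX.
  rewrite (degenerate_stirling1P lambda) rmorph_sum mulr_sumr.
  rewrite [RHS]big_ord_recl scale0r add0r.
  under [RHS]eq_bigr => i _ do rewrite /= scaler_suml.
  rewrite exchange_big /=; apply: eq_bigr => l _.
  rewrite comp_polyZ (rmorph_dff (comp_poly ('X - 1))) /= comp_polyC comp_polyX.
  rewrite -scalerAr (mulX_dff_sub1 _ (ltn_ord l)) scaler_sumr.
  by apply: eq_bigr => i _; rewrite scalerA.
rewrite /s.
(* The terms with [l < m] contribute nothing. *)
rewrite -(big_mkord xpredT (fun l => degenerate_stirling1 lambda k l * b l m)).
rewrite (big_cat_nat (leq0n m) (leqW le_mk)) /=.
rewrite big_nat_cond big1 ?add0r => [|l]; last first.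
  rewrite andbT => /andP[_ lt_lm].
  by rewrite /b mulX_dff_sub1_coef_small ?mulr0.
by apply: eq_big_nat => l /andP[le_ml _]; rewrite -mulX_dff_sub1_coefE.
Qed.
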